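(* Let $n\ge 1$ be an integer, let $x_i,x_j\in\mathbb{R}^n$, and let $\sigma_i>0$, $\sigma_j>0$ be real numbers. Let $k_{\sigma_i}(x_i,\cdot)$ and $k_{\sigma_j}(x_j,\cdot)$ be the isotropic Gaussian kernels $$k_{\sigma_i}(x_i,x)=\frac{1}{(2\pi)^{n/2}\sigma_i^n}\exp\left\{-\frac{\|x_i-x\|^2}{2\sigma_i^2}\right\},\qquad k_{\sigma_j}(x_j,x)=\frac{1}{(2\pi)^{n/2}\sigma_j^n}\exp\left\{-\frac{\|x_j-x\|^2}{2\sigma_j^2}\right\},\qquad x\in\mathbb{R}^n.$$ Then $$\left\langle k_{\sigma_i}(x_i,\cdot),k_{\sigma_j}(x_j,\cdot)\right\rangle=\int_{\mathbb{R}^n}k_{\sigma_i}(x_i,x)\,k_{\sigma_j}(x_j,x)\,dx=\frac{1}{(2\pi)^{n/2}\left(\sigma_i^2+\sigma_j^2\right)^{n/2}}\exp\left\{-\frac{\|x_i-x_j\|^2}{2\left(\sigma_i^2+\sigma_j^2\right)}\right\}.$$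
   Context: $\|\cdot\|$ is the Euclidean norm on $\mathbb{R}^n$. For $f,g\in L_2(\mathbb{R}^n)$ (real-valued square integrable functions), the inner product is $\langle f,g\rangle=\int_{\mathbb{R}^n}f(x)g(x)\,dx$ (Lebesgue measure). *)

(* Defs.v *)
From HB Require Import structures.
From mathcomp Require Import all_boot all_order all_algebra.
From mathcomp Require Import all_classical all_reals all_analysis.

Set Implicit Arguments.
Unset Strict Implicit.
Unset Printing Implicit Defensive.
Import Order.TTheory GRing.Theory Num.Theory.
Import numFieldNormedType.Exports.

Local Open Scope classical_set_scope.
Local Open Scope ring_scope.

(* Points of R^n are n-tuples: n.-tuple R carries the product sigma-algebra
   (the one generated by the coordinate projections), which 'rV[R]_n lacks. *)

Definition tuple_sub (R : realType) (n : nat) (x y : n.-tuple R) : n.-tuple R :=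
  [tuple tnth x k - tnth y k | k < n].

(* The norm that row vectors inherit from the library is the sup norm, hence
   this definition. *)
Definition euclidean_norm (R : realType) (n : nat) (x : n.-tuple R) : R :=
  Num.sqrt (\sum_(k < n) tnth x k ^+ 2).

Section lebesgue_cons.
Context (R : realType) (n : nat).

Definition tuple_cons (z : R * n.-tuple R) : n.+1.-tuple R :=
  [tuple of z.1 :: z.2].

Definition tuple_uncons (x : n.+1.-tuple R) : R * n.-tuple R :=
  (thead x, [tuple of behead x]).

Lemma measurable_tuple_cons : measurable_fun [set: R * n.-tuple R] tuple_cons.
Proof.
exact: (@measurable_cons _ _ _ R fst n snd measurable_fst measurable_snd).
Qed.

Lemma measurable_tuple_uncons : measurable_fun [set: n.+1.-tuple R] tuple_uncons.
Proof.
apply/measurable_fun_pairP; split; first exact: measurable_tnth.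
exact: measurable_behead.
Qed.

Lemma tuple_consK : cancel tuple_cons tuple_uncons.
Proof.
by move=> [a x]; rewrite /tuple_uncons /tuple_cons /=; congr (_, _); exact: val_inj.
Qed.

Variable mu : {sigma_finite_measure set (n.-tuple R) -> \bar R}.

Definition lebesgue_cons : set (n.+1.-tuple R) -> \bar R :=
  pushforward (lebesgue_measure \x mu)%E tuple_cons.

Let lebesgue_cons0 : lebesgue_cons set0 = 0%E.
Proof. by rewrite /lebesgue_cons /pushforward preimage_set0 measure0. Qed.

Let lebesgue_cons_ge0 A : (0 <= lebesgue_cons A)%E.
Proof. exact: (measure_ge0 (lebesgue_measure \x mu)%E). Qed.

Let lebesgue_cons_sigma_additive : semi_sigma_additive lebesgue_cons.
Proof.
have mc := measurable_tuple_cons.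
pose m : {measure set (n.+1.-tuple R) -> \bar R} :=
  measure_function_pushforward__canonical__measure_function_Measure
    (lebesgue_measure \x mu)%E mc.
exact: (@measure_semi_sigma_additive _ _ _ m).
Qed.

HB.instance Definition _ := isMeasure.Build _ _ _ lebesgue_cons
  lebesgue_cons0 lebesgue_cons_ge0 lebesgue_cons_sigma_additive.

Let lebesgue_cons_sigma_finite : sigma_finite setT lebesgue_cons.
Proof.
have /sigma_finiteP[F [TF ndF Foo]] := sigma_finiteT (@lebesgue_measure R).
have /sigma_finiteP[G [TG ndG Goo]] := sigma_finiteT mu.
exists (fun k => tuple_uncons @^-1` (F k `*` G k)).
  rewrite -preimage_bigcup; apply/seteqP; split => // x _ /=.
  have [i _ Fi] : (\bigcup_k F k) (thead x) by rewrite -TF.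
  have [j _ Gj] : (\bigcup_k G k) [tuple of behead x] by rewrite -TG.
  exists (maxn i j) => //; split.
    by move: Fi; exact/subsetPset/ndF/leq_maxl.
  by move: Gj; exact/subsetPset/ndG/leq_maxr.
move=> k; have [mF Fk] := Foo k; have [mG Gk] := Goo k.
split.
  by rewrite -[X in measurable X]setTI; apply: measurable_tuple_uncons => //;
    exact: measurableX.
rewrite /lebesgue_cons /pushforward -comp_preimage.
rewrite (_ : _ \o _ = id); last by apply/funext => z /=; exact: tuple_consK.
by rewrite preimage_id product_measure1E// lte_mul_pinfty// ge0_fin_numE.
Qed.

HB.instance Definition _ := Measure_isSigmaFinite.Build _ _ _ lebesgue_cons
  lebesgue_cons_sigma_finite.

End lebesgue_cons.

Section lebesgue_tuple.
Context (R : realType).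

(* n-dimensional Lebesgue measure, by iterated products of the one-dimensional
   one; on R^0 it is the unit mass at the only point. *)
Fixpoint lebesgue_tuple (n : nat) :
    {sigma_finite_measure set (n.-tuple R) -> \bar R} :=
  match n with
  | 0 => [the {sigma_finite_measure set (0.-tuple R) -> \bar R}
            of dirac [tuple]]
  | n'.+1 => [the {sigma_finite_measure set (n'.+1.-tuple R) -> \bar R}
                of lebesgue_cons (lebesgue_tuple n')]
  end.

(* This determines the measure: boxes form a generating pi-system. *)
Lemma lebesgue_tuple_box (n : nat) (A : 'I_n -> set R) :
  (forall k, measurable (A k)) ->
  lebesgue_tuple n [set x | forall k, A k (tnth x k)] =
  (\prod_(k < n) @lebesgue_measure R (A k))%E.
Proof.
elim: n A => [|n IH] A mA.
  rewrite big_ord0 /= diracE mem_set//= => -[]//.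
rewrite big_ord_recl -IH//= /lebesgue_cons /pushforward.
have -> : @tuple_cons R n @^-1` [set x | forall k, A k (tnth x k)] =
    A ord0 `*` [set x : n.-tuple R | forall k, A (lift ord0 k) (tnth x k)].
  apply/seteqP; split => -[a x] /=.
    move=> H; split; first exact: (H ord0).
    by move=> k; have := H (lift ord0 k); rewrite tnthS.
  move=> [Aa Ax] k; case: (unliftP ord0 k) => [j|] ->; last exact: Aa.
  by rewrite tnthS; exact: Ax.
set B := [set x | _].
have -> : B = \bigcap_(k in [set: 'I_n])
    ((fun x : n.-tuple R => tnth x k) @^-1` A (lift ord0 k)).
  by apply/seteqP; split => x /= H k; [move=> _|]; exact: H.
apply: product_measure1E; first exact: mA.
apply: fin_bigcap_measurable => // k _.
by rewrite -[X in measurable X]setTI; exact: measurable_tnth.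
Qed.

End lebesgue_tuple.

Definition gauss_kernel (R : realType) (n : nat) (s : R) (c x : n.-tuple R) : R :=
  ((2 * pi) `^ (n%:R / 2) * s ^+ n)^-1 *
  expR (- (euclidean_norm (tuple_sub c x) ^+ 2 / (2 * s ^+ 2))).

(* The inner product of L2(R^n); only meaningful for f, g in L2. *)
Definition L2_inner (R : realType) (n : nat) (f g : n.-tuple R -> R) : R :=
  (\int[lebesgue_tuple R n]_x (f x * g x))%R.

(* Main.v *)
(** Both kernels are products over the coordinates of one-dimensional normal
    densities, so by Tonelli the inner product factors into one-dimensional
    integrals.  In dimension one, completing the square shows that the product
    of the densities with parameters (a, s) and (b, t) is, as a function of x,
    a constant times a normal density, the constant being the density with
    centre a and deviation sqrt (s^2 + t^2) evaluated at b.  The product of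
    these constants over the coordinates is again a Gaussian kernel.  Square
    integrability is the special case of two equal kernels. *)
Require Import Defs.
From mathcomp Require Import all_boot all_order all_algebra.
From mathcomp Require Import all_classical all_reals all_analysis.
From mathcomp Require Import measurable_realfun ring.
Import Order.TTheory GRing.Theory Num.Theory.
Local Open Scope ring_scope.

Lemma measurable_prod_tnth (R : realType) (n : nat) (f : 'I_n -> R -> R) :
  (forall k, measurable_fun setT (f k)) ->
  measurable_fun setT (fun x : n.-tuple R => \prod_(k < n) f k (tnth x k)).
Proof.
move=> mf; apply: measurable_prod => k _.
by apply: measurableT_comp; [exact: mf | exact: measurable_tnth].
Qed.

(** Induction on [n]: the measure on [n.+1]-tuples is the image of a product measure under
    [tuple_cons], so a change of variables and Tonelli split off the first coordinate. *)
Lemma integral_lebesgue_tuple_prod (R : realType) (n : nat)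
    (f : 'I_n -> R -> R) :
  (forall k, measurable_fun setT (f k)) -> (forall k x, 0 <= f k x) ->
  (\int[lebesgue_tuple R n]_x (\prod_(k < n) f k (tnth x k))%:E =
   \prod_(k < n) \int[@lebesgue_measure R]_y (f k y)%:E)%E.
Proof.
elim: n f => [|n IH] f mf f0.
  under eq_integral do rewrite big_ord0.
  (* On R^0 the measure is a Dirac mass, so the empty product integrates to 1. *)
  rewrite big_ord0 integral_cst//= mul1e.
  by rewrite diracE mem_set.
pose g (x : n.-tuple R) := \prod_(k < n) f (lift ord0 k) (tnth x k).
have mg : measurable_fun setT g.
  by apply: (measurable_prod_tnth _ _ (fun k => f (lift ord0 k))) => k.
have g0 x : 0 <= g x by exact: prodr_ge0.
have consE z : \prod_(k < n.+1) f k (tnth (@tuple_cons R n z) k) =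
    f ord0 z.1 * g z.2.
  rewrite big_ord_recl; congr (_ * _); apply: eq_bigr => k _.
  by rewrite tnthS; congr (f _ (tnth _ k)); exact: val_inj.
have mfg : measurable_fun setT (fun z : R * n.-tuple R => f ord0 z.1 * g z.2).
  apply: measurable_funM; first exact: (measurableT_comp (mf _) measurable_fst).
  exact: (measurableT_comp mg measurable_snd).
transitivity (\int[(@lebesgue_measure R \x lebesgue_tuple R n)%E]_z
    (f ord0 z.1 * g z.2)%:E)%E.
  (* The two measures are convertible; this form exposes the pushforward for the change of
     variables. *)
  transitivity (\int[pushforward (@lebesgue_measure R \x lebesgue_tuple R n)%E
      (@tuple_cons R n)]_x (\prod_(k < n.+1) f k (tnth x k))%:E)%E.
    by [].
  rewrite ge0_integral_pushforward//.
  - by rewrite preimage_setT; apply: eq_integral => z _ /=; rewrite consE.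
  - exact: measurable_tuple_cons.
  - by apply/measurable_EFinP; exact: (measurable_prod_tnth _ _ f).
  - by move=> x _; rewrite lee_fin prodr_ge0.
rewrite fubini_tonelli1; first last.
- by move=> z; rewrite lee_fin mulr_ge0.
- exact/measurable_EFinP.
have mgE : measurable_fun setT (EFin \o g) by exact/measurable_EFinP.
have mf0E : measurable_fun setT (EFin \o f ord0) by exact/measurable_EFinP.
rewrite big_ord_recl -IH//.
rewrite -ge0_integralZr//.
- apply: eq_integral => x _; rewrite /fubini_F/=.
  under eq_integral do rewrite EFinM.
  by rewrite ge0_integralZl_EFin// => y _; rewrite lee_fin.
- by move=> x _; rewrite lee_fin; exact: f0.
- by apply: integral_ge0 => y _; rewrite lee_fin; exact: g0.
Qed.

Lemma sqrtr_sqr_sum_gt0 (R : realType) (s t : R) : 0 < s -> 0 < t ->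
  0 < Num.sqrt (s ^+ 2 + t ^+ 2).
Proof. by move=> s0 t0; rewrite sqrtr_gt0 addr_gt0// exprn_gt0. Qed.

(** Taking [s] out of the root gives the form whose [n]-th power is the constant of
    [gauss_kernel]. *)
Lemma normal_peakE (R : realType) (s : R) : 0 < s ->
  normal_peak s = (Num.sqrt (2 * pi) * s)^-1.
Proof.
move=> s0; rewrite /normal_peak -mulrnAr -mulr_natl sqrtrM ?sqr_ge0//.
by rewrite sqrtr_sqr gtr0_norm// mulrC.
Qed.

(** With r = st/S and m the mean of a and b weighted by 1/s^2 and 1/t^2, one has (x-a)^2/s^2 +
    (x-b)^2/t^2 = (b-a)^2/S^2 + (x-m)^2/r^2. The peaks agree since S r = s t. *)
Lemma normal_pdfM (R : realType) (a b s t x : R) : 0 < s -> 0 < t ->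
  let S := Num.sqrt (s ^+ 2 + t ^+ 2) in
  normal_pdf a s x * normal_pdf b t x =
  normal_pdf a S b *
  normal_pdf ((a * t ^+ 2 + b * s ^+ 2) / (s ^+ 2 + t ^+ 2)) (s * t / S) x.
Proof.
move=> s0 t0 S.
have S0 : 0 < S by exact: sqrtr_sqr_sum_gt0.
have r0 : 0 < s * t / S by rewrite divr_gt0// mulr_gt0.
have S2 : S ^+ 2 = s ^+ 2 + t ^+ 2.
  by rewrite sqr_sqrtr// addr_ge0// sqr_ge0.
have p0 : 0 < Num.sqrt (2 * pi) :> R by rewrite sqrtr_gt0 mulr_gt0// pi_gt0.
rewrite !normal_pdfE ?gt_eqF// !normal_peakE// /normal_fun.
rewrite mulrACA [RHS]mulrACA -!expRD; congr (_ * expR _).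
  by field; rewrite !gt_eqF.
(* Only even powers of [S] occur in the exponents, so the root disappears and a rational identity
   remains. *)
rewrite !expr_div_n !exprMn S2.
field; rewrite -S2 !sqrf_eq0/= !gt_eqF//.
Qed.

Lemma integral_normal_pdfM (R : realType) (a b s t : R) : 0 < s -> 0 < t ->
  (\int[@lebesgue_measure R]_x (normal_pdf a s x * normal_pdf b t x)%:E =
   (normal_pdf a (Num.sqrt (s ^+ 2 + t ^+ 2)) b)%:E)%E.
Proof.
move=> s0 t0.
under eq_integral do rewrite normal_pdfM// EFinM.
rewrite ge0_integralZl_EFin//.
- by rewrite integral_normal_pdf mule1.
- by move=> x _; rewrite lee_fin normal_pdf_ge0.
- by apply/measurable_EFinP; exact: measurable_normal_pdf.
- exact: normal_pdf_ge0.
Qed.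

Lemma powR_natr_half (R : realType) (n : nat) (a : R) : 0 <= a ->
  a `^ (n%:R / 2) = Num.sqrt a ^+ n.
Proof.
by move=> a0; rewrite mulrC powRrM powR12_sqrt// powR_mulrn.
Qed.

Lemma gauss_kernel_prod (R : realType) (n : nat) (s : R) (c x : n.-tuple R) :
  0 < s ->
  gauss_kernel s c x = \prod_(k < n) normal_pdf (tnth c k) s (tnth x k).
Proof.
move=> s0; under eq_bigr do rewrite normal_pdfE ?gt_eqF// normal_peakE//.
rewrite big_split/= prodr_const card_ord /normal_fun -expR_sum.
rewrite /gauss_kernel powR_natr_half ?mulr_ge0 ?pi_ge0// -exprMn exprVn.
congr (_ * expR _).
rewrite /euclidean_norm sqr_sqrtr; last by apply: sumr_ge0 => k _; exact: sqr_ge0.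
rewrite -mulNr -sumrN mulr_suml; apply: eq_bigr => k _.
(* The kernel squares centre minus point, the density point minus centre. *)
by rewrite tnth_mktuple mulr_natl -[in RHS]sqrrN opprB.
Qed.

Lemma gauss_kernel_ge0 (R : realType) (n : nat) (s : R) (c x : n.-tuple R) :
  0 < s -> 0 <= gauss_kernel s c x.
Proof.
move=> s0; rewrite gauss_kernel_prod// prodr_ge0// => k _.
exact: normal_pdf_ge0.
Qed.

Lemma measurable_gauss_kernel (R : realType) (n : nat) (s : R)
    (c : n.-tuple R) :
  0 < s -> measurable_fun setT (gauss_kernel s c).
Proof.
move=> s0; rewrite (_ : gauss_kernel s c = fun x =>
  \prod_(k < n) normal_pdf (tnth c k) s (tnth x k)).
  apply: (measurable_prod_tnth _ _ (fun k => normal_pdf (tnth c k) s)) => k.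
  exact: measurable_normal_pdf.
by apply/funext => x; exact: gauss_kernel_prod.
Qed.

Lemma integral_gauss_kernelM (R : realType) (n : nat) (c d : n.-tuple R)
    (s t : R) : 0 < s -> 0 < t ->
  (\int[lebesgue_tuple R n]_x (gauss_kernel s c x * gauss_kernel t d x)%:E =
   (gauss_kernel (Num.sqrt (s ^+ 2 + t ^+ 2)) c d)%:E)%E.
Proof.
move=> s0 t0.
under eq_integral do rewrite !gauss_kernel_prod// -big_split/=.
rewrite (@integral_lebesgue_tuple_prod R n (fun k y =>
  normal_pdf (tnth c k) s y * normal_pdf (tnth d k) t y)).
- under eq_bigr do rewrite integral_normal_pdfM//.
  (* The one-dimensional constants are the coordinate factors of the kernel centred at [c],
     evaluated at [d]. *)
  by rewrite prodEFin gauss_kernel_prod// sqrtr_sqr_sum_gt0.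
- by move=> k; apply: measurable_funM; exact: measurable_normal_pdf.
- by move=> k x; rewrite mulr_ge0// normal_pdf_ge0.
Qed.

Lemma gauss_kernel_Lfun2 (R : realType) (n : nat) (s : R) (c : n.-tuple R) :
  0 < s -> gauss_kernel s c \in Lfun (lebesgue_tuple R n) 2%:E.
Proof.
move=> s0; apply/andP; split; rewrite inE/=.
  exact: measurable_gauss_kernel.
(* The norm is a power of the integral of the squared kernel, so finiteness of that integral
   suffices. *)
rewrite /finite_norm unlock/= poweR_lty//.
under eq_integral => x _.
  rewrite powR_mulrn// ger0_norm ?gauss_kernel_ge0// expr2.
  over.
by rewrite integral_gauss_kernelM// ltry.
Qed.

Theorem mainTheorem1 (R : realType) (n : nat) (hn : (1 <= n)%N)
    (xi xj : n.-tuple R) (si sj : R) (hsi : 0 < si) (hsj : 0 < sj) :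
  [/\ gauss_kernel si xi \in Lfun (lebesgue_tuple R n) 2%:E,
      gauss_kernel sj xj \in Lfun (lebesgue_tuple R n) 2%:E,
      L2_inner (gauss_kernel si xi) (gauss_kernel sj xj) =
        \int[lebesgue_tuple R n]_x (gauss_kernel si xi x * gauss_kernel sj xj x)
    & \int[lebesgue_tuple R n]_x (gauss_kernel si xi x * gauss_kernel sj xj x) =
        ((2 * pi) `^ (n%:R / 2) * (si ^+ 2 + sj ^+ 2) `^ (n%:R / 2))^-1 *
        expR (- (euclidean_norm (tuple_sub xi xj) ^+ 2
                 / (2 * (si ^+ 2 + sj ^+ 2))))].
Proof.
have S0 : 0 <= si ^+ 2 + sj ^+ 2 by rewrite addr_ge0// sqr_ge0.
split=> //; try exact: gauss_kernel_Lfun2.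
(* The extended integral is a real number, so passing to its real part keeps the value. *)
rewrite /Rintegral integral_gauss_kernelM//= /gauss_kernel (sqr_sqrtr S0).
by rewrite [X in _ = (_ * X)^-1 * _]powR_natr_half.
Qed.
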